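(* Let $G_{\mathrm{im}}\colon \mathbb{R}^{6\times 2}\to[0,\infty)$ be the restriction of $G$ to $(\operatorname{Im}\mathbb{H})^2\times(\operatorname{Im}\mathbb{H})^2\cong\mathbb{R}^{6\times 2}$, and let $G_{\mathrm{im}}^T\colon\mathbb{R}^{2\times 6}\to[0,\infty)$ be its transpose, $G_{\mathrm{im}}^T(A):=G_{\mathrm{im}}(A^T)$. Then both $G_{\mathrm{im}}$ and $G_{\mathrm{im}}^T$ are rank-one convex but not quasiconvex.
   Context: Let $\mathbb{T}^n$ be the periodic torus (e.g. $\mathbb{T}^n=\mathbb{R}^n/(2\pi\mathbb{Z})^n$). A locally Lipschitz function $F\colon\mathbb{R}^{m\times n}\to\mathbb{R}$ is called quasiconvex if for all $A\in\mathbb{R}^{m\times n}$ and all $\varphi\in C^\infty(\mathbb{T}^n,\mathbb{R}^m)$, $\int_{\mathbb{T}^n}[F(A+D\varphi)-F(A)]\,dx\ge 0$; it is called rank-one convex if for all $A,X\in\mathbb{R}^{m\times n}$ with $\operatorname{rank}(X)=1$ the function $t\mapsto F(A+tX)$ is convex on $\mathbb{R}$. $\mathbb{H}$ denotes the real quaternions with units $\mathbf{i},\mathbf{j},\mathbf{k}$, and $\operatorname{Im}\mathbb{H}=\{w_1\mathbf{i}+w_2\mathbf{j}+w_3\mathbf{k}: (w_1,w_2,w_3)\in\mathbb{R}^3\}$ the purely imaginary quaternions. For $\xi=(\xi_1,\xi_2),\eta=(\eta_1,\eta_2)\in\mathbb{H}^2$ set $\langle\xi,\eta\rangle_{\mathbb{H}^2}:=\xi_1\overline{\eta_1}+\xi_2\overline{\eta_2}\in\mathbb{H}$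 and $\|\xi\|_{\mathbb{H}^2}^2:=\langle\xi,\xi\rangle_{\mathbb{H}^2}=|\xi_1|^2+|\xi_2|^2$. Define $$G\colon\mathbb{H}^2\times\mathbb{H}^2\to[0,\infty),\qquad G(\xi,\eta):=\sqrt{\|\xi\|_{\mathbb{H}^2}^2\|\eta\|_{\mathbb{H}^2}^2-|\langle\xi,\eta\rangle_{\mathbb{H}^2}|^2}.$$ Identifying $\mathbb{H}^2\cong\mathbb{R}^8$ by real components, a pair $(\xi,\eta)$ is regarded as the matrix in $\mathbb{R}^{8\times 2}$ with columns $\xi,\eta$. Likewise $(\operatorname{Im}\mathbb{H})^2\cong\mathbb{R}^6$ via $(u_1\mathbf{i}+u_2\mathbf{j}+u_3\mathbf{k},\,v_1\mathbf{i}+v_2\mathbf{j}+v_3\mathbf{k})\leftrightarrow(u_1,u_2,u_3,v_1,v_2,v_3)$, and a pair $(\xi,\eta)\in(\operatorname{Im}\mathbb{H})^2\times(\operatorname{Im}\mathbb{H})^2$ is regarded as the matrix in $\mathbb{R}^{6\times 2}$ with columns $\xi,\eta$. *)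

(* Defs.v *)
From HB Require Import structures.
From mathcomp Require Import all_boot all_order all_algebra.
From mathcomp Require Import ring.
From mathcomp Require Import all_classical all_reals all_analysis.

Set Implicit Arguments.
Unset Strict Implicit.
Unset Printing Implicit Defensive.

Import Order.TTheory GRing.Theory Num.Theory.
Import numFieldNormedType.Exports.

Local Open Scope classical_set_scope.
Local Open Scope ring_scope.

(* Lebesgue measure on R^n, carried by the measurable type n.-tuple R (whose
   sigma-algebra is the product of the Borel ones): the image of the product
   measure on R * R^n under (t, x) |-> t :: x, starting from the unit point
   mass on R^0. It is characterized by [lebesgue_tuple_box] below. *)
Section lebesgue_tuple.
Context {R : realType}.
Local Open Scope ereal_scope.

Definition tuple_consf n (p : measurableTypeR R * n.-tuple (measurableTypeR R))
  : n.+1.-tuple (measurableTypeR R) := [the n.+1.-tuple _ of p.1 :: p.2].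

Lemma measurable_tuple_consf n : measurable_fun setT (@tuple_consf n).
Proof. exact: (measurable_cons measurable_fst measurable_snd). Qed.

Section step.
Variables (n : nat)
  (mu : {sigma_finite_measure set (n.-tuple (measurableTypeR R)) -> \bar R}).

Definition cons_measure :=
  pushforward ((@lebesgue_measure R) \x mu) (@tuple_consf n).

Let cons_measure0 : cons_measure set0 = 0.
Proof. by rewrite /cons_measure /pushforward preimage_set0 measure0. Qed.

Let cons_measure_ge0 A : 0 <= cons_measure A.
Proof. by rewrite /cons_measure /pushforward; apply: measure_ge0. Qed.

Let cons_measure_sigma_additive : semi_sigma_additive cons_measure.
Proof.
move=> F mF tF mUF; rewrite /cons_measure /pushforward preimage_bigcup.
apply: measure_semi_sigma_additive.
- by move=> k; rewrite -[X in measurable X]setTI; apply: measurable_tuple_consf.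
- apply/trivIsetP => i j _ _ ij; rewrite -preimage_setI.
  by move/trivIsetP : tF => -> //; rewrite preimage_set0.
- by rewrite -preimage_bigcup -[X in measurable X]setTI;
    apply: measurable_tuple_consf.
Qed.

HB.instance Definition _ := isMeasure.Build _ _ _ cons_measure
  cons_measure0 cons_measure_ge0 cons_measure_sigma_additive.

Let cons_measure_sigma_finite : sigma_finite setT cons_measure.
Proof.
have /sigma_finiteP[F [TF ndF Foo]] := sigma_finiteT (@lebesgue_measure R).
have /sigma_finiteP[H [TH ndH Hoo]] := sigma_finiteT mu.
pose g (x : n.+1.-tuple (measurableTypeR R))
  : measurableTypeR R * n.-tuple (measurableTypeR R) :=
  (thead x, [tuple of behead x]).
have mg : measurable_fun setT g.
  apply/measurable_fun_pair => /=.
    exact: measurable_tnth.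
  exact: measurable_behead.
have gK : cancel (@tuple_consf n) g.
  move=> [t x]; rewrite /g /tuple_consf /=; congr (_, _).
  exact: val_inj.
exists (fun k => g @^-1` (F k `*` H k)).
  rewrite -preimage_bigcup (_ : \bigcup_k _ = setT) ?preimage_setT//.
  apply/seteqP; split => // -[t x] _.
  have [k _ Fkt] : (\bigcup_k F k) t by rewrite -TF.
  have [l _ Hlx] : (\bigcup_k H k) x by rewrite -TH.
  exists (maxn k l) => //; split => /=.
    by move: t Fkt; exact/subsetPset/ndF/leq_maxl.
  by move: x Hlx; exact/subsetPset/ndH/leq_maxr.
move=> k; have [mFk Fk] := Foo k; have [mHk Hk] := Hoo k; split.
  by rewrite -[X in measurable X]setTI; apply: mg => //; exact: measurableX.
rewrite /cons_measure /pushforward.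
rewrite (_ : _ @^-1` _ = F k `*` H k); last first.
  by rewrite -comp_preimage (_ : _ \o _ = id)//; apply/funext => p /=.
by rewrite product_measure1E// lte_mul_pinfty// ge0_fin_numE.
Qed.

HB.instance Definition _ := Measure_isSigmaFinite.Build _ _ _ cons_measure
  cons_measure_sigma_finite.

End step.

Fixpoint lebesgue_tuple n
  : {sigma_finite_measure set (n.-tuple (measurableTypeR R)) -> \bar R} :=
  match n with
  | 0 => \d_[tuple]
  | n'.+1 => cons_measure (lebesgue_tuple n')
  end.

Lemma lebesgue_tuple_box n (A : 'I_n -> set (measurableTypeR R)) :
  (forall i, measurable (A i)) ->
  lebesgue_tuple n [set x | forall i, A i (tnth x i)] =
  \prod_(i < n) lebesgue_measure (A i).
Proof.
elim: n A => [|n IH] A mA.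
  rewrite big_ord0 /= diracE (_ : _ \in _ = true)//.
  by apply/mem_set => -[].
rewrite big_ord_recl /= /cons_measure /pushforward.
set B := [set x | forall i, A (lift ord0 i) (tnth x i)].
have mB : measurable B.
  rewrite (_ : B = \bigcap_(i in [set: 'I_n])
      ((fun x => tnth x i) @^-1` A (lift ord0 i))).
    apply: fin_bigcap_measurable => // i _.
    by rewrite -[X in measurable X]setTI; apply: measurable_tnth.
  apply/seteqP; split => [x h i _|x h i]; first exact: h.
  exact: (h i I).
rewrite (_ : _ @^-1` _ = A ord0 `*` B); last first.
  apply/seteqP; split => -[t x] /=.
    move=> h; split; first exact: (h ord0).
    by move=> i; have := h (lift ord0 i); rewrite tnthS.
  move=> [h0 h] i; case: (unliftP ord0 i) => [j|] ->; last exact: h0.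
  by rewrite tnthS; exact: h.
rewrite product_measure1E//; congr (_ * _).
exact: (IH (fun i => A (lift ord0 i))).
Qed.

End lebesgue_tuple.

Section calculus.
Context {R : realType}.

Definition partial n (i : 'I_n) (f : 'rV[R]_n -> R) : 'rV[R]_n -> R :=
  fun x => 'D_(delta_mx 0 i) f x.

Definition iter_partial n (s : seq 'I_n) (f : 'rV[R]_n -> R) :=
  foldr (@partial n) f s.

Definition smooth n (f : 'rV[R]_n -> R) :=
  forall s : seq 'I_n, continuous (iter_partial s f) /\
    forall (i : 'I_n) (x : 'rV[R]_n), derivable (iter_partial s f) x (delta_mx 0 i).

(* Functions on the torus R^n / (2 pi Z)^n are encoded as functions on R^n
   that are 2 pi-periodic in each variable. *)
Definition periodic n m (phi : 'rV[R]_n -> 'cV[R]_m) :=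
  forall (i : 'I_n) (x : 'rV[R]_n), phi (x + (2 * pi) *: delta_mx 0 i) = phi x.

Definition smooth_torus_map n m (phi : 'rV[R]_n -> 'cV[R]_m) :=
  (forall k : 'I_m, smooth (fun x => phi x k 0)) /\ periodic phi.

Definition Dmx n m (phi : 'rV[R]_n -> 'cV[R]_m) (x : 'rV[R]_n) : 'M[R]_(m, n) :=
  \matrix_(k, i) partial i (fun y => phi y k 0) x.

Definition torus_cell n : set (n.-tuple (measurableTypeR R)) :=
  [set x | forall i, tnth x i \in `[0, 2 * pi]].

Definition torus_integral n (f : 'rV[R]_n -> R) : \bar R :=
  \int[lebesgue_tuple n]_(x in @torus_cell n) (f (\row_i tnth x i))%:E.

(* In the literature the notion is reserved for locally Lipschitz F, which
   makes the integrand below continuous; the defining inequality itself does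
   not refer to this regularity. *)
Definition quasiconvex m n (F : 'M[R]_(m, n) -> R) :=
  forall (A : 'M[R]_(m, n)) (phi : 'rV[R]_n -> 'cV[R]_m),
    smooth_torus_map phi ->
    (0 <= torus_integral (fun x => F (A + Dmx phi x) - F A)%R)%E.

Definition rank_one_convex m n (F : 'M[R]_(m, n) -> R) :=
  forall A X : 'M[R]_(m, n), \rank X = 1%N ->
    convex_function [set: R^o] (fun t : R => F (A + t *: X)).

End calculus.

(* Quat a b c d is a + b i + c j + d k. *)
Record quat (R : Type) := Quat { q0 : R; q1 : R; q2 : R; q3 : R }.

Section quaternions.
Context {R : realType}.
Implicit Types p q : quat R.

Definition addq p q : quat R :=
  Quat (q0 p + q0 q) (q1 p + q1 q) (q2 p + q2 q) (q3 p + q3 q).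

Definition mulq p q : quat R :=
  Quat (q0 p * q0 q - q1 p * q1 q - q2 p * q2 q - q3 p * q3 q)
       (q0 p * q1 q + q1 p * q0 q + q2 p * q3 q - q3 p * q2 q)
       (q0 p * q2 q - q1 p * q3 q + q2 p * q0 q + q3 p * q1 q)
       (q0 p * q3 q + q1 p * q2 q - q2 p * q1 q + q3 p * q0 q).

Definition conjq q : quat R := Quat (q0 q) (- q1 q) (- q2 q) (- q3 q).

Definition normq q : R :=
  Num.sqrt (q0 q ^+ 2 + q1 q ^+ 2 + q2 q ^+ 2 + q3 q ^+ 2).

Definition H2 := (quat R * quat R)%type.

Definition innerH2 (xi eta : H2) : quat R :=
  addq (mulq xi.1 (conjq eta.1)) (mulq xi.2 (conjq eta.2)).

Definition sqnormH2 (xi : H2) : R := normq xi.1 ^+ 2 + normq xi.2 ^+ 2.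

Lemma innerH2_self (xi : H2) : innerH2 xi xi = Quat (sqnormH2 xi) 0 0 0.
Proof.
case: xi => [[a b c d] [a' b' c' d']].
rewrite /sqnormH2 /normq /innerH2 /addq /mulq /conjq /=.
rewrite !sqr_sqrtr ?addr_ge0 ?sqr_ge0//.
by congr Quat; ring.
Qed.

Definition G (xi eta : H2) : R :=
  Num.sqrt (sqnormH2 xi * sqnormH2 eta - normq (innerH2 xi eta) ^+ 2).

(* The identification R^6 = (Im H)^2; the numerals are row indices in 'I_6. *)
Definition imH2 (u : 'cV[R]_6) : H2 :=
  (Quat 0 (u 0 0) (u 1 0) (u 2 0), Quat 0 (u 3 0) (u 4 0) (u 5 0)).

Definition Gim (A : 'M[R]_(6, 2)) : R := G (imH2 (col 0 A)) (imH2 (col 1 A)).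

Definition GimT (A : 'M[R]_(2, 6)) : R := Gim A^T.

End quaternions.

(* Main.v *)
From Stdlib Require Import ZArith Lia.
Require Import Defs.
From mathcomp Require Import all_boot all_order all_algebra.
From mathcomp Require Import all_classical all_reals all_analysis.
From mathcomp Require Import measurable_realfun zify ssrZ.
From mathcomp Require Import ring lra.

(** Write a pair of vectors of (Im H)^2 as xi = (a, b), eta = (c, d) with
    a, b, c, d in R^3.  Then
      G^2 = |xi|^2 |eta|^2 - (a.c + b.d)^2 - |a x c + b x d|^2,
    a quadratic form Q in the bivector xi /\ eta.

    Rank-one convexity.  Along a line with direction of rank one the bivector
    xi /\ eta is affine in the parameter, so G^2 is a quadratic polynomial
    there; it is nonnegative (Cauchy-Schwarz in H^2), and the square root of a
    nonnegative quadratic polynomial is convex.  Transposing does not change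
    the set of these lines.

    Quasiconvexity of G_im.  It fails at xi = (i, k), eta = (j, k), where G^2 is
    2.  Along three rank-one directions, with frequencies (1,0), (0,1), (1,1),
    the function is constant through that point, but the three directions
    interact at third order: with amplitudes r, s, t,
      G^2 = 2 (1 - 4 r s t + (r s)^2 + (r t)^2 + (s t)^2).
    For r = cos x, s = cos y, t = cos (x + y) the mean of r s t is 1/4 and the
    mean of each square is 1/4, so G^2 has mean less than 2, and the tangent line
    of the square root turns this into a mean of G below its value at the point.

    Quasiconvexity of the transpose.  Take xi = N (k, 0), eta = N (0, k) and
    perturb in the i and j directions only, by gradients (a, b) and (c, -a) of
    planar vectors; this is what keeps the second variation of G at the base
    point a null Lagrangian.  Then, with planar cross products,
      G^2 = (N^2 + q)^2 + D,  q = |a|^2 + b.c,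
      D = (b x c)^2 - 4 (a x b) (a x c).
    The integral of q vanishes, as q is a combination of 2 x 2 minors of the
    gradient, so for large N the sign of the mean of G - N^2 is that of the mean
    of D.  With phi_1 = f(y) - f(x + y) and phi_2 = f(x + y) - f(x), x and y in
    the plane, and f even with Fourier coefficients f_k, put
    C_ij = f'(z_i) x f'(z_j) for z_1 = x, z_2 = y, z_3 = - x - y.  Then
      D = C_12^2 + C_23^2 + C_31^2 - 2 (C_12 C_23 + C_23 C_31 + C_31 C_12),
    whose mean is
      3 sum_(k, l) (k x l)^2 f_k f_l (f_k f_l - 2 f_(k+l)^2).
    For three waves of equal amplitude with k_1 + k_2 + k_3 = 0 this is exactly
    0; a fourth wave that is a difference of two of them, with small positive
    amplitude, enters linearly and makes the mean negative.

    Both means are means of trigonometric polynomials with integer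
    coefficients, which are evaluated by computation; [not_quasiconvex_trig]
    transfers the outcome to the integral over the torus. *)

Set Implicit Arguments.
Unset Strict Implicit.
Unset Printing Implicit Defensive.

Import Order.TTheory GRing.Theory Num.Theory.
Import numFieldNormedType.Exports.

#[local] Delimit Scope Z_scope with BZ.

Local Open Scope classical_set_scope.
Local Open Scope ring_scope.

(** * The square of G and rank-one convexity *)

Section rank_one_convexity.
Context {R : realType}.

(** The square of G at xi = (a, b), eta = (c, d): for imaginary quaternions
    p (conj q) = p.q - p x q. *)
Definition gram_im (a0 a1 a2 b0 b1 b2 c0 c1 c2 d0 d1 d2 : R) : R :=
  (a0 ^+ 2 + a1 ^+ 2 + a2 ^+ 2 + b0 ^+ 2 + b1 ^+ 2 + b2 ^+ 2) *
  (c0 ^+ 2 + c1 ^+ 2 + c2 ^+ 2 + d0 ^+ 2 + d1 ^+ 2 + d2 ^+ 2) -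
  ((a0 * c0 + a1 * c1 + a2 * c2 + b0 * d0 + b1 * d1 + b2 * d2) ^+ 2 +
   (a1 * c2 - a2 * c1 + (b1 * d2 - b2 * d1)) ^+ 2 +
   (a2 * c0 - a0 * c2 + (b2 * d0 - b0 * d2)) ^+ 2 +
   (a0 * c1 - a1 * c0 + (b0 * d1 - b1 * d0)) ^+ 2).

Lemma G_imE a0 a1 a2 b0 b1 b2 c0 c1 c2 d0 d1 d2 :
  G (Quat 0 a0 a1 a2, Quat 0 b0 b1 b2) (Quat 0 c0 c1 c2, Quat 0 d0 d1 d2) =
  Num.sqrt (gram_im a0 a1 a2 b0 b1 b2 c0 c1 c2 d0 d1 d2).
Proof.
rewrite /G /sqnormH2 /normq /innerH2 /Defs.addq /Defs.mulq /conjq /=.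
rewrite !sqr_sqrtr ?addr_ge0 ?sqr_ge0 //; congr Num.sqrt; rewrite /gram_im /=; ring.
Qed.

(** Cauchy-Schwarz in H^2: with n = |eta|^2 and q the H-valued product of xi
    and eta, n G^2 is the squared norm of n xi - q eta. *)
Lemma gram_im_ge0 a0 a1 a2 b0 b1 b2 c0 c1 c2 d0 d1 d2 :
  0 <= gram_im a0 a1 a2 b0 b1 b2 c0 c1 c2 d0 d1 d2.
Proof.
set n := c0 ^+ 2 + c1 ^+ 2 + c2 ^+ 2 + d0 ^+ 2 + d1 ^+ 2 + d2 ^+ 2.
set s := a0 * c0 + a1 * c1 + a2 * c2 + b0 * d0 + b1 * d1 + b2 * d2.
set w0 := a1 * c2 - a2 * c1 + (b1 * d2 - b2 * d1).
set w1 := a2 * c0 - a0 * c2 + (b2 * d0 - b0 * d2).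
set w2 := a0 * c1 - a1 * c0 + (b0 * d1 - b1 * d0).
(* q = s - w, so its product with c is s c + w.c - w x c. *)
have E : n * gram_im a0 a1 a2 b0 b1 b2 c0 c1 c2 d0 d1 d2 =
  (w0 * c0 + w1 * c1 + w2 * c2) ^+ 2 + (w0 * d0 + w1 * d1 + w2 * d2) ^+ 2
  + (n * a0 - s * c0 + (w1 * c2 - w2 * c1)) ^+ 2
  + (n * a1 - s * c1 + (w2 * c0 - w0 * c2)) ^+ 2
  + (n * a2 - s * c2 + (w0 * c1 - w1 * c0)) ^+ 2
  + (n * b0 - s * d0 + (w1 * d2 - w2 * d1)) ^+ 2
  + (n * b1 - s * d1 + (w2 * d0 - w0 * d2)) ^+ 2
  + (n * b2 - s * d2 + (w0 * d1 - w1 * d0)) ^+ 2.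
  by rewrite /gram_im /w0 /w1 /w2 /s /n; ring.
have n0 : 0 <= n by rewrite !addr_ge0 ?sqr_ge0.
move: n0; rewrite le_eqVlt => /orP[/eqP n0|n0]; last first.
  by rewrite -(pmulr_rge0 _ n0) E !addr_ge0 ?sqr_ge0.
(* The remaining case is eta = 0. *)
have z x : x ^+ 2 <= n -> x = 0.
  by rewrite -n0 => h; apply/eqP; rewrite -sqrf_eq0 eq_le h sqr_ge0.
have [-> -> -> [-> -> ->]] :
    [/\ c0 = 0, c1 = 0, c2 = 0 & [/\ d0 = 0, d1 = 0 & d2 = 0]].
  have := (sqr_ge0 c0, sqr_ge0 c1, sqr_ge0 c2, sqr_ge0 d0, sqr_ge0 d1, sqr_ge0 d2).
  move=> [[[[[h0 h1] h2] h3] h4] h5].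
  by split; last split; apply: z; rewrite /n; lra.
rewrite le_eqVlt; apply/orP; left; apply/eqP; rewrite /gram_im; ring.
Qed.

(** Minkowski's inequality for the nonnegative quadratic form whose values at
    (t, 1) are f t: the square root is a seminorm, restricted to a line. *)
Lemma convex_sqrt_quadratic (f : R -> R) (a b c : R) :
  (forall t, f t = a * t ^+ 2 + 2 * b * t + c) -> (forall t, 0 <= f t) ->
  convex_function [set: R^o] (fun t : R => Num.sqrt (f t)).
Proof.
move=> fE f0.
have disc : b ^+ 2 <= a * c.
  have := deg_le2_poly_ge0 (size_Poly [:: c; 2 * b; a]); rewrite !coef_Poly => H.
  have : (2 * b) ^+ 2 - 4 * a * c <= 0.
    apply: H => x; rewrite horner_Poly /= -[X in _ <= X](_ : f x = _) //.
    by rewrite fE; ring.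
  by nra.
move=> l s t _ _; rewrite [X in _ <= X]convRE.
have -> : conv l s t = l%:num * s + (1 - l%:num) * t by exact: convRE.
have m0 : 0 <= l%:num :> R by exact: ge0.
have m1 : 0 <= 1 - l%:num :> R by rewrite subr_ge0; exact: le1.
rewrite /unstable.onem; move: (l%:num) m0 m1 => m m0 m1.
set x := m * s + _; set fs := Num.sqrt (f s); set ft := Num.sqrt (f t).
have fs0 : 0 <= fs by exact: sqrtr_ge0.
have ft0 : 0 <= ft by exact: sqrtr_ge0.
have fsE : fs ^+ 2 = f s by exact: sqr_sqrtr.
have ftE : ft ^+ 2 = f t by exact: sqr_sqrtr.
(* Cauchy-Schwarz for the polar form, by the sign of the discriminant. *)
have polar : a * s * t + b * (s + t) + c <= fs * ft.
  apply: le_trans (ler_norm _) _.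
  rewrite -(ler_pXn2r (n := 2)) ?nnegrE ?mulr_ge0 // real_normK ?num_real //.
  rewrite exprMn fsE ftE !fE -subr_ge0.
  rewrite [X in 0 <= X](_ : _ = (a * c - b ^+ 2) * (s - t) ^+ 2); last by ring.
  by rewrite mulr_ge0 ?sqr_ge0 // subr_ge0.
rewrite -(ler_pXn2r (n := 2)) ?nnegrE ?addr_ge0 ?mulr_ge0 ?sqrtr_ge0 // sqr_sqrtr //.
have -> : f x = m ^+ 2 * f s + (1 - m) ^+ 2 * f t
    + 2 * m * (1 - m) * (a * s * t + b * (s + t) + c).
  by rewrite !fE /x; ring.
rewrite -fsE -ftE.
have := ler_wpM2l (mulr_ge0 m0 m1) polar.
by rewrite /=; nra.
Qed.

Definition Gim_gram (A : 'M[R]_(6, 2)) :=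
  gram_im (A 0 0) (A 1 0) (A 2 0) (A 3 0) (A 4 0) (A 5 0)
    (A 0 1) (A 1 1) (A 2 1) (A 3 1) (A 4 1) (A 5 1).

Lemma GimE (A : 'M[R]_(6, 2)) : Gim A = Num.sqrt (Gim_gram A).
Proof. by rewrite /Gim /imH2 G_imE !mxE. Qed.

(** The coefficients of t^3 and t^4 vanish because the direction has rank one;
    the three others are then read off at -1, 0 and 1. *)
Lemma gram_im_rank_one a0 a1 a2 b0 b1 b2 c0 c1 c2 d0 d1 d2
    x0 x1 x2 y0 y1 y2 p q (t : R) :
  let P t := gram_im (a0 + t * (x0 * p)) (a1 + t * (x1 * p)) (a2 + t * (x2 * p))
     (b0 + t * (y0 * p)) (b1 + t * (y1 * p)) (b2 + t * (y2 * p))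
     (c0 + t * (x0 * q)) (c1 + t * (x1 * q)) (c2 + t * (x2 * q))
     (d0 + t * (y0 * q)) (d1 + t * (y1 * q)) (d2 + t * (y2 * q)) in
  2 * P t = (P 1 + P (-1) - 2 * P 0) * t ^+ 2 + (P 1 - P (- 1)) * t + 2 * P 0.
Proof.
by rewrite /= /gram_im; ring.
Qed.

Lemma Gim_gram_line (A X : 'M[R]_(6, 2)) (t : R) : \rank X = 1%N ->
  let P t := Gim_gram (A + t *: X) in
  P t = ((P 1 + P (-1)) / 2 - P 0) * t ^+ 2 + 2 * ((P 1 - P (-1)) / 4) * t + P 0.
Proof.
move=> rX P.
have [u [v Xuv]] : exists (u : 'cV[R]_6) (v : 'rV[R]_2), X = u *m v.
  have := mulmx_base X; move: (col_base X) (row_base X); rewrite rX => u v <-.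
  by exists u, v.
have XE i j : X i j = u i 0 * v 0 j by rewrite Xuv mxE big_ord1.
have := gram_im_rank_one (A 0 0) (A 1 0) (A 2 0) (A 3 0) (A 4 0) (A 5 0)
  (A 0 1) (A 1 1) (A 2 1) (A 3 1) (A 4 1) (A 5 1)
  (u 0 0) (u 1 0) (u 2 0) (u 3 0) (u 4 0) (u 5 0) (v 0 0) (v 0 1) t.
have PE s : P s = Gim_gram (\matrix_(i, j) (A i j + s * (u i 0 * v 0 j))).
  by rewrite /P; congr Gim_gram; apply/matrixP => i j; rewrite !mxE XE.
rewrite !PE /Gim_gram !mxE /= => H.
apply: (mulfI (_ : 2 != 0)); first by rewrite pnatr_eq0.
by rewrite H; field.
Qed.

Lemma rank_one_convex_Gim : rank_one_convex (@Gim R).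
Proof.
move=> A X rX.
rewrite (_ : (fun t => _) = fun t => Num.sqrt (Gim_gram (A + t *: X))); last first.
  by apply/funext => t; rewrite GimE.
apply: convex_sqrt_quadratic => t; first exact: Gim_gram_line.
exact: gram_im_ge0.
Qed.

Lemma rank_one_convex_GimT : rank_one_convex (@GimT R).
Proof.
move=> A X rX.
rewrite (_ : (fun t => _) = fun t => Gim (A^T + t *: X^T)).
  by apply: rank_one_convex_Gim; rewrite mxrank_tr.
by apply/funext => t; rewrite /GimT linearD linearZ.
Qed.

End rank_one_convexity.

(** * Trigonometric polynomials with integer data *)

(** A term (c, j :: k) stands for c cos (k.x + j pi / 2).  The phase in quarter
    turns heads the frequency, so that sines need no terms of their own and
    products and derivatives act on frequencies alone; missing entries of a
    frequency count as zero. *)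
Definition tpoly := seq (Z * seq Z).

Fixpoint freq_add (k l : seq Z) : seq Z :=
  match k, l with
  | [::], _ => l
  | _, [::] => k
  | a :: k', b :: l' => Z.add a b :: freq_add k' l'
  end.

Definition tscale (c : Z) (p : tpoly) : tpoly :=
  [seq (Z.mul c t.1, t.2) | t <- p].

(** Twice the product, since 2 cos a cos b = cos (a + b) + cos (a - b); the
    factor keeps the coefficients integral. *)
Definition tmul (p q : tpoly) : tpoly :=
  flatten [seq [seq (Z.mul s.1 t.1, freq_add s.2 t.2) | t <- q] ++
               [seq (Z.mul s.1 t.1, freq_add s.2 (map Z.opp t.2)) | t <- q]
          | s <- p].

Fixpoint tinsert (t : Z * seq Z) (p : tpoly) : tpoly :=
  match p with
  | [::] => [:: t]
  | s :: p' =>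
      if s.2 == t.2 then
        let c := Z.add s.1 t.1 in if Z.eqb c Z0 then p' else (c, s.2) :: p'
      else s :: tinsert t p'
  end.

(** Merging equal frequencies keeps iterated products short enough to be
    computed with. *)
Definition tcollect (p : tpoly) : tpoly :=
  foldr (fun t r => if Z.eqb t.1 Z0 then r else tinsert t r) [::] p.

Definition tderiv (i : nat) (p : tpoly) : tpoly :=
  [seq (Z.mul t.1 (nth Z0 t.2 i.+1), freq_add t.2 [:: 1%BZ]) | t <- p].

(** cos (j pi / 2) *)
Definition cos_quarter (j : Z) : Z :=
  match Z.modulo j 4 with 0%BZ => 1%BZ | 2%BZ => (-1)%BZ | _ => 0%BZ end.

(** The head of the frequency is exempt, being a phase. *)
Definition const_freq n (k : seq Z) : bool :=
  all (fun i => Z.eqb (nth Z0 k i.+1) Z0) (iota 0 n).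

Definition tmean n (p : tpoly) : Z :=
  foldr (fun t r => if const_freq n t.2
                    then Z.add (Z.mul t.1 (cos_quarter (nth Z0 t.2 0))) r
                    else r) Z0 p.

Definition tnorm (p : tpoly) : Z := foldr (fun t r => Z.add (Z.abs t.1) r) Z0 p.

Section eval.
Context {R : realType}.

Definition realZ (z : Z) : R := (int_of_Z z)%:~R.
Local Notation zr := realZ.

Lemma zrD a b : zr (Z.add a b) = zr a + zr b.
Proof. by rewrite /realZ -intrD -rmorphD. Qed.
Lemma zrM a b : zr (Z.mul a b) = zr a * zr b.
Proof. by rewrite /realZ -intrM -rmorphM. Qed.
Lemma zrN a : zr (Z.opp a) = - zr a.
Proof. by rewrite /realZ -intrN -rmorphN. Qed.
Lemma zr0 : zr 0%BZ = 0. Proof. by []. Qed.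
Lemma zr1 : zr 1%BZ = 1. Proof. by []. Qed.
Lemma zr_le a b : Z.leb a b -> zr a <= zr b.
Proof. by move=> h; rewrite /realZ ler_int; lia. Qed.
Lemma zr_abs a : zr (Z.abs a) = `|zr a|.
Proof. by rewrite /realZ -intr_norm; congr intmul; lia. Qed.
Lemma zr_eq0 a : (zr a == 0) = Z.eqb a Z0.
Proof. by rewrite /realZ intr_eq0; lia. Qed.

Definition tangle n (k : seq Z) (x : 'rV[R]_n) : R :=
  zr (nth Z0 k 0) * (pi / 2) + \sum_(i < n) zr (nth Z0 k i.+1) * x 0 i.

Definition teval n (p : tpoly) (x : 'rV[R]_n) : R :=
  \sum_(t <- p) zr t.1 * cos (tangle t.2 x).

Lemma nth_freq_add k l i :
  nth Z0 (freq_add k l) i = Z.add (nth Z0 k i) (nth Z0 l i).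
Proof.
elim: k l i => [|a k IH] [|b l] [|i] //=; rewrite ?nth_nil; try lia.
Qed.

Lemma nth_map_opp k i : nth Z0 (map Z.opp k) i = Z.opp (nth Z0 k i).
Proof. by elim: k i => [|a k IH] [|i] /=. Qed.

Lemma tangle_add n k l (x : 'rV_n) :
  tangle (freq_add k l) x = tangle k x + tangle l x.
Proof.
rewrite /tangle nth_freq_add zrD mulrDl addrACA -big_split /=; congr (_ + _).
by apply: eq_bigr => i _; rewrite nth_freq_add zrD mulrDl.
Qed.

Lemma tangle_opp n k (x : 'rV_n) : tangle (map Z.opp k) x = - tangle k x.
Proof.
rewrite /tangle nth_map_opp zrN mulNr opprD -sumrN; congr (_ + _).
by apply: eq_bigr => i _; rewrite nth_map_opp zrN mulNr.
Qed.

Lemma teval_cat n p q (x : 'rV_n) : teval (p ++ q) x = teval p x + teval q x.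
Proof. by rewrite /teval big_cat. Qed.

Lemma teval_cons n t p (x : 'rV_n) :
  teval (t :: p) x = zr t.1 * cos (tangle t.2 x) + teval p x.
Proof. by rewrite /teval big_cons. Qed.

Lemma teval_scale n c p (x : 'rV_n) : teval (tscale c p) x = zr c * teval p x.
Proof.
by rewrite /teval big_map mulr_sumr; apply: eq_bigr => t _; rewrite zrM mulrA.
Qed.

Lemma cos_mul_cos (c d a b : R) :
  c * d * cos (a + b) + c * d * cos (a - b) = 2 * (c * cos a * (d * cos b)).
Proof. by rewrite cosD cosB; ring. Qed.

Lemma teval_mul n p q (x : 'rV_n) :
  teval (tmul p q) x = 2 * teval p x * teval q x.
Proof.
rewrite /teval big_flatten /= big_map -mulrA mulr_suml mulr_sumr.
apply: eq_bigr => s _; rewrite big_cat !big_map /= -big_split !mulr_sumr.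
apply: eq_bigr => t _ /=.
by rewrite !tangle_add tangle_opp !zrM; exact: cos_mul_cos.
Qed.

Lemma teval_collect n p (x : 'rV_n) : teval (tcollect p) x = teval p x.
Proof.
have ins t q : teval (tinsert t q) x = zr t.1 * cos (tangle t.2 x) + teval q x.
  elim: q => [|s q IH] //=; first by rewrite teval_cons.
  case: ifPn => [/eqP st|_]; last by rewrite !teval_cons IH addrCA.
  case: ifPn => [|_]; last by rewrite !teval_cons /= st zrD mulrDl -addrA addrCA.
  rewrite -zr_eq0 zrD addr_eq0 => /eqP h.
  by rewrite teval_cons st h mulNr addrA subrr add0r.
elim: p => [|t p IH] //=; rewrite teval_cons -IH.
by case: ifPn => [|_]; [rewrite -zr_eq0 => /eqP ->; rewrite mul0r add0r|rewrite ins].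
Qed.

Lemma norm_teval_le n p (x : 'rV_n) : `|teval p x| <= zr (tnorm p).
Proof.
elim: p => [|t p IH]; first by rewrite /teval big_nil normr0.
rewrite teval_cons /= zrD zr_abs (le_trans (ler_normD _ _))// lerD//.
by rewrite normrM ler_piMr// cos_max.
Qed.

Lemma tangle_shift n k (i : 'I_n) h (x : 'rV_n) :
  tangle k (h *: delta_mx 0 i + x) = h * zr (nth Z0 k i.+1) + tangle k x.
Proof.
rewrite /tangle addrCA; congr (_ + _).
under eq_bigr do rewrite !mxE mulrDr.
rewrite big_split /=; congr (_ + _).
rewrite (bigD1 i)//= [X in _ + X]big1 ?addr0 => [|j /negPf ji].
  by rewrite !eqxx mulr1 mulrC.
by rewrite ji mulr0 mulr0.
Qed.

End eval.

(** * Derivatives, smoothness and periodicity *)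

Section calculus_of_trigonometric_polynomials.
Context {R : realType}.
Local Notation zr := (@realZ R).

(** Reduces a directional derivative to the derivative of a function of one
    real variable. *)
Lemma is_derive_along n (f : 'rV[R]_n -> R) (x v : 'rV[R]_n) (g : R -> R)
    (d : R) :
  (forall h, f (h *: v + x) = g h) -> is_derive (0 : R) (1 : R) g d ->
  is_derive x v f d.
Proof.
move=> fg [dg gd].
have E : (fun h : R => h^-1 *: ((f \o shift x) (h *: v) - f x)) =
         (fun h : R => h^-1 *: ((g \o shift 0) (h *: (1 : R)) - g 0)).
  apply/funext => h /=.
  rewrite fg -[in f x](add0r x) -[in f (0 + x)](scale0r v) fg.
  by rewrite addr0 [h *: 1](mulr1 h).
by split; [rewrite /derivable E|rewrite -gd /derive E].
Qed.

(** The derivative advances the phase by a quarter turn. *)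
Lemma is_derive_cos_tangle n k (i : 'I_n) (x : 'rV[R]_n) :
  is_derive x (delta_mx 0 i) (fun y => cos (tangle k y))
    (zr (nth Z0 k i.+1) * cos (tangle (freq_add k [:: 1%BZ]) x)).
Proof.
set a := zr _; set c := tangle k x.
apply: (@is_derive_along _ _ _ _ (fun h => cos (h * a + c))).
  by move=> h; rewrite tangle_shift.
have d1 : is_derive (0 : R) (1 : R) (fun h : R => h * a + c) a.
  rewrite (_ : (fun _ => _) = (a \*: (@id R)) + cst c); last first.
    by apply/funext => h; rewrite mulrC.
  apply: is_derive_eq.
  by rewrite addr0 [_ *: _]mulr1.
have := @is_derive1_comp R cos (fun h => h * a + c) 0 _ _ (is_derive_cos _) d1.
rewrite tangle_add /(tangle [:: _]) /= zr1 mul1r big1 ?addr0; last first.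
  by move=> j _; rewrite nth_nil mul0r.
rewrite mul0r add0r cosDpihalf mulrN.
by rewrite mulNr [sin c * a]mulrC.
Qed.

Lemma is_derive_teval n p (i : 'I_n) (x : 'rV[R]_n) :
  is_derive x (delta_mx 0 i) (teval p) (teval (tderiv i p) x).
Proof.
elim: p => [|t p IH].
  rewrite /teval !big_nil (_ : (fun _ => _) = cst 0); first exact: is_derive_cst.
  by apply/funext => y; rewrite big_nil.
rewrite (_ : teval (t :: p) =
    (zr t.1 \*: (fun y => cos (tangle t.2 y))) + teval p); last first.
  by apply/funext => y; rewrite teval_cons.
rewrite /= teval_cons /= zrM -mulrA.
apply: is_deriveD.
apply: is_deriveZ.
exact: is_derive_cos_tangle.
Qed.

Lemma partial_teval n p (i : 'I_n) :
  partial i (teval p) = teval (tderiv i p) :> ('rV[R]_n -> R).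
Proof.
by apply/funext => x; have := is_derive_teval p i x => -[_].
Qed.

Lemma continuous_sum_seq (T : topologicalType) (I : Type) (r : seq I)
    (F : I -> T -> R) :
  (forall i, continuous (F i)) -> continuous (fun x => \sum_(i <- r) F i x).
Proof.
move=> cF; elim: r => [|i r IH] x.
  under eq_fun do rewrite big_nil; exact: cvg_cst.
under eq_fun do rewrite big_cons.
by apply: (@continuousD _ R^o); [exact: cF|exact: IH].
Qed.

Lemma continuous_tangle n k : continuous (@tangle R n k).
Proof.
have cs : continuous (fun x : 'rV[R]_n => \sum_(i < n) zr (nth Z0 k i.+1) * x 0 i).
  apply: continuous_sum_seq => i x.
  by apply: continuousM; [exact: cst_continuous|exact: coord_continuous].
move=> x; pose phase := zr (nth Z0 k 0) * (pi / 2).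
exact: (@continuousD _ R^o _ (cst phase) _ x (@cst_continuous _ _ _ x) (cs x)).
Qed.

Lemma continuous_teval n p : continuous (@teval R n p).
Proof.
apply: continuous_sum_seq => t x; apply: continuousM; first exact: cst_continuous.
by apply: continuous_comp; [exact: continuous_tangle|exact: continuous_cos].
Qed.

Lemma smooth_teval n p : smooth (@teval R n p).
Proof.
move=> s.
have -> : iter_partial s (teval p) =
    teval (foldr (fun i : 'I_n => tderiv i) p s) :> ('rV[R]_n -> R).
  by elim: s => //= i s ->; rewrite partial_teval.
split; first exact: continuous_teval.
by move=> i x; have [] := is_derive_teval (foldr (fun i : 'I_n => tderiv i) p s) i x.
Qed.

Lemma cos_int_periodic (z : int) (a : R) : cos (a + z%:~R * (2 * pi)) = cos a.
Proof.
have nat_per (m : nat) b : cos (b + m%:R * (pi *+ 2) : R) = cos b.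
  elim: m b => [|m IH] b; first by rewrite mul0r addr0.
  by rewrite -natr1 mulrDl mul1r addrA cosD2pi IH.
rewrite (mulr_natl pi 2).
case: z => m; first exact: nat_per.
rewrite -[LHS](nat_per m.+1 _); congr cos.
by rewrite NegzE mulrNz mulNr -pmulrn -addrA addNr addr0.
Qed.

Lemma teval_periodic n p (i : 'I_n) (x : 'rV[R]_n) :
  teval p (x + (2 * pi) *: delta_mx 0 i) = teval p x.
Proof.
apply: eq_bigr => t _; congr (_ * _).
by rewrite addrC tangle_shift addrC [2 * _ * _]mulrC cos_int_periodic.
Qed.

Definition tmap m n (p : seq tpoly) (x : 'rV[R]_n) : 'cV[R]_m :=
  \col_(k < m) teval (nth [::] p k) x.

Lemma smooth_tmap m n p : smooth_torus_map (@tmap m n p).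
Proof.
split=> [k|i x].
  rewrite (_ : (fun x => _) = teval (nth [::] p k)); first exact: smooth_teval.
  by apply/funext => x; rewrite mxE.
by apply/matrixP => k j; rewrite !mxE teval_periodic.
Qed.

Lemma Dmx_tmap m n p (x : 'rV[R]_n) :
  Dmx (@tmap m n p) x = \matrix_(k < m, i < n) teval (tderiv i (nth [::] p k)) x.
Proof.
apply/matrixP => k i; rewrite !mxE -partial_teval; congr (partial _ _ _).
by apply/funext => y; rewrite mxE.
Qed.

End calculus_of_trigonometric_polynomials.

(** * Means over the torus *)

Section torus_integrals.
Context {R : realType}.
Local Notation zr := (@realZ R).

Lemma integral_cos_affine (m : int) (c : R) :
  (\int[lebesgue_measure]_(t in `[0%R, (2 * pi)%R]) (cos (c + m%:~R * t))%:E =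
  (if m == 0 then 2 * pi * cos c else 0)%:E)%E.
Proof.
have pi2 : 0 < 2 * pi :> R by rewrite mulr_gt0 ?pi_gt0.
case: ifPn => [/eqP ->|m0].
  under eq_integral do rewrite mul0r addr0.
  rewrite integral_cst //= lebesgue_measure_itv /= lte_fin pi2 -EFinB -EFinM.
  by rewrite subr0 mulrC.
have mR : m%:~R != 0 :> R by rewrite intr_eq0.
pose F t : R := m%:~R^-1 * sin (c + m%:~R * t).
have dF t : is_derive t (1 : R) F (cos (c + m%:~R * t)).
  have d1 : is_derive t (1 : R) (fun t : R => c + m%:~R * t) m%:~R.
    rewrite (_ : (fun _ => _) = cst c + (m%:~R \*: (@id R))); last exact/funext.
    by apply: is_derive_eq; rewrite add0r [_ *: _]mulr1.
  have := @is_derive1_comp R sin (fun t => c + m%:~R * t) t _ _ (is_derive_sin _) d1.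
  move=> /(is_deriveZ m%:~R^-1) H.
  apply: (@is_derive_eq _ _ _ _ _ _ _ _ H).
  by rewrite [_ *: _]mulrC mulfK.
have cF : continuous F.
  by move=> t; apply/differentiable_continuous/derivable1_diffP; have [] := dF t.
rewrite (@continuous_FTC2 R _ F) //.
- rewrite /F mulr0 addr0 -EFinB.
  rewrite -(subrr (m%:~R^-1 * sin c)); congr (_ - _)%:E; congr (_ * _).
  by rewrite -!cosBpihalf addrAC cos_int_periodic.
- apply: continuous_subspaceT => t.
  apply: continuous_comp; last exact: continuous_cos.
  apply: (@continuousD _ R^o); first exact: cst_continuous.
  by apply: continuousM; [exact: cst_continuous|exact: id].
- split.
  + by move=> t _; have [] := dF t.
  + exact/cvg_at_right_filter/cF.
  + exact/cvg_at_left_filter/cF.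
- by move=> t _; rewrite derive1E; have [] := dF t.
Qed.

Lemma measurable_torus_cell n : measurable (@torus_cell R n).
Proof.
rewrite (_ : @torus_cell R n = \bigcap_(i in [set: 'I_n])
    ((fun x : n.-tuple (measurableTypeR R) => tnth x i) @^-1` `[0%R, 2 * pi]%classic)).
  apply: fin_bigcap_measurable => // i _.
  by rewrite -[X in measurable X]setTI; apply: measurable_tnth.
by apply/seteqP; split => [x h i _|x h i]; [exact: h|exact: (h i I)].
Qed.

Lemma lebesgue_measure_period :
  lebesgue_measure `[0%R, 2 * pi]%classic = (2 * pi)%:E :> \bar R.
Proof.
by rewrite lebesgue_measure_itv /= lte_fin mulr_gt0 ?pi_gt0// -EFinB subr0.
Qed.

Lemma torus_cell_lty n : (lebesgue_tuple n (@torus_cell R n) < +oo)%E.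
Proof.
have -> : @torus_cell R n =
  [set x | forall i : 'I_n, `[0%R, 2 * pi]%classic (tnth x i)] by [].
rewrite (@lebesgue_tuple_box R n (fun=> `[0%R, 2 * pi]%classic))//.
rewrite (eq_bigr (fun=> (2 * pi)%:E)) => [|i _]; first by rewrite prodEFin ltry.
exact: lebesgue_measure_period.
Qed.

Lemma integrable_torus_cell n (f : n.-tuple (measurableTypeR R) -> R) (M : R) :
  measurable_fun setT f -> (forall x, `|f x| <= M) ->
  (lebesgue_tuple n).-integrable (@torus_cell R n) (EFin \o f).
Proof.
move=> mf bf; apply: measurable_bounded_integrable.
- exact: measurable_torus_cell.
- exact: torus_cell_lty.
- exact: measurable_funTS.
- exists M; split; [exact: num_real|] => y My x _; exact: le_trans (bf x) (ltW My).
Qed.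

Lemma measurable_linear_tuple n (k : 'I_n -> int) (c : R) :
  measurable_fun setT
    (fun x : n.-tuple (measurableTypeR R) =>
      c + \sum_(i < n) (k i)%:~R * tnth x i).
Proof.
apply: measurable_funD => //; apply: measurable_sum => i.
by apply: measurable_funM => //; exact: measurable_tnth.
Qed.

Lemma measurable_cos_tuple n (k : 'I_n -> int) (c : R) :
  measurable_fun setT
    (fun x : n.-tuple (measurableTypeR R) =>
      cos (c + \sum_(i < n) (k i)%:~R * tnth x i)).
Proof.
apply: (@measurableT_comp _ _ _ _ _ _ (@cos R)); last exact: measurable_linear_tuple.
by apply: continuous_measurable_fun; exact: continuous_cos.
Qed.

(** Fubini, one variable at a time: the phase c absorbs the variables already
    fixed, and a nonzero frequency in any variable kills the integral. *)
Lemma integral_torus_cos n (k : 'I_n -> int) (c : R) :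
  (\int[lebesgue_tuple n]_(x in @torus_cell R n)
     (cos (c + \sum_(i < n) (k i)%:~R * tnth x i))%:E =
  (if [forall i, k i == 0] then (2 * pi) ^+ n * cos c else 0)%:E)%E.
Proof.
elim: n k c => [|n IH] k c.
  rewrite integral_dirac //; last 2 first.
  - exact: measurable_torus_cell.
  - apply/measurable_EFinP; apply: measurable_funTS.
    exact: measurable_cos_tuple.
  rewrite diracE mem_set ?mul1e; last by case.
  rewrite big_ord0 addr0 expr0 mul1r ifT //.
  by apply/forallP => -[].
pose f (x : n.+1.-tuple (measurableTypeR R)) :=
  cos (c + \sum_(i < n.+1) (k i)%:~R * tnth x i).
have mf : measurable_fun setT (fun x : n.+1.-tuple (measurableTypeR R) => (f x)%:E).
  by apply/measurable_EFinP; exact: measurable_cos_tuple.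
pose J : set (measurableTypeR R) := `[0%R, 2 * pi]%classic.
have mJ : measurable J by exact: measurable_itv.
have cellE : @tuple_consf R n @^-1` (@torus_cell R n.+1) = J `*` (@torus_cell R n).
  apply/seteqP; split => -[t x] /=.
    move=> h; split; first exact: (h ord0).
    by move=> i; have := h (lift ord0 i); rewrite tnthS.
  move=> [h0 h] i; case: (unliftP ord0 i) => [j|] ->; last exact: h0.
  by rewrite tnthS; exact: h.
have mcell : measurable (J `*` (@torus_cell R n)).
  by apply: measurableX; [exact: mJ|exact: measurable_torus_cell].
have Plty : (((@lebesgue_measure R) \x (lebesgue_tuple n))
    (J `*` (@torus_cell R n)) < +oo)%E.
  rewrite product_measure1E //; last exact: measurable_torus_cell.
  rewrite lte_mul_pinfty //; last exact: torus_cell_lty.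
  rewrite ge0_fin_numE // /J; apply: (le_lt_trans _ (ltry (2 * pi))).
  by rewrite -lebesgue_measure_period.
have intf : ((@lebesgue_measure R) \x (lebesgue_tuple n))%E.-integrable
    (@tuple_consf R n @^-1` (@torus_cell R n.+1))
    ((fun x => (f x)%:E) \o @tuple_consf R n).
  rewrite cellE; apply: (@measurable_bounded_integrable _ _ _ _ (f \o @tuple_consf R n)) => //.
  - apply: measurable_funTS; apply: measurableT_comp; first exact: measurable_cos_tuple.
    exact: measurable_tuple_consf.
  - exists 1; split; [exact: num_real|] => y My x _; exact: le_trans (cos_max _) (ltW My).
transitivity (\int[(@lebesgue_measure R) \x (lebesgue_tuple n)]_(p in
    J `*` (@torus_cell R n)) (f (tuple_consf p))%:E)%E.
  rewrite -cellE; apply: (integral_pushforward _ mf intf).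
    exact: measurable_tuple_consf.
  exact: measurable_torus_cell.
rewrite cellE in intf.
rewrite integral_mkcond -integral12_prod_meas1; last first.
  by apply: (iffLR (integrable_mkcond _ mcell)); exact: intf.
transitivity (\int[lebesgue_measure]_(t in `[0%R, (2 * pi)%R]%classic)
    (\int[lebesgue_tuple n]_(x in @torus_cell R n)
     (cos ((c + (k ord0)%:~R * t) +
       \sum_(i < n) (k (lift ord0 i))%:~R * tnth x i))%:E))%E.
  rewrite [RHS]integral_mkcond; apply: eq_integral => t _.
  rewrite /fubini_F patchE; case: ifPn => tJ.
    rewrite [RHS]integral_mkcond; apply: eq_integral => x _.
    rewrite !patchE in_setX [t \in _]tJ /=; case: ifP => // _.
    rewrite /f big_ord_recl addrA; congr (cos (_ + _ * _ + _))%:E.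
    by apply: eq_bigr => i _; rewrite tnthS.
  rewrite (eq_integral (cst 0%E)) ?integral0 // => x _.
  by rewrite patchE in_setX [t \in _](negPf tJ).
under eq_integral do rewrite IH.
have -> : [forall i, k i == 0] = (k ord0 == 0) && [forall i, k (lift ord0 i) == 0].
  apply/forallP/andP => [h|[h0 /forallP h] i].
    by split; [exact: h|apply/forallP => i; exact: h].
  by case: (unliftP ord0 i) => [j|] ->; [exact: h|exact: h0].
case: [forall i, k (lift ord0 i) == 0]; last by rewrite andbF integral0.
under eq_integral do rewrite EFinM.
rewrite integralZl //; last first.
  apply: continuous_compact_integrable; first exact: segment_compact.
  apply: continuous_subspaceT => t.
  apply: continuous_comp; last exact: continuous_cos.
  apply: (@continuousD _ R^o); first exact: cst_continuous.
  by apply: continuousM; [exact: cst_continuous|exact: id].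
rewrite integral_cos_affine -EFinM andbT; case: ifP => _; last by rewrite mulr0.
by rewrite exprSr [in LHS]mulrA.
Qed.

(** Monotonicity for arbitrary functions, since the integral is a difference of
    suprema over simple functions; it spares a proof that the integrand of
    [quasiconvex] is measurable. *)
Lemma le_integral_pointwise d (T : measurableType d)
    (mu : {measure set T -> \bar R})
    (D : set T) (f g : T -> \bar R) :
  (forall x, D x -> (f x <= g x)%E) ->
  (\int[mu]_(x in D) f x <= \int[mu]_(x in D) g x)%E.
Proof.
move=> fg.
have fgD x : ((f \_ D) x <= (g \_ D) x)%E.
  by rewrite !patchE; case: ifPn => // /set_mem; exact: fg.
rewrite /integral; apply: leeB; apply: le_ereal_sup => _ [h hle <-];
  exists h => // x; apply: le_trans (hle x) _.
  by rewrite !funeposE ge_max !le_max fgD lexx orbT.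
by rewrite !funenegE ge_max !le_max leeN2 fgD lexx orbT.
Qed.

Lemma cos_quarterE j : cos (zr j * (pi / 2)) = zr (cos_quarter j).
Proof.
have E : j = Z.add (Z.modulo j 4) (Z.mul (Z.div j 4) 4).
  by rewrite Z.mul_comm Z.add_comm; exact: Z_div_mod_eq_full.
have -> : cos (zr j * (pi / 2)) = cos (zr (Z.modulo j 4) * (pi / 2)).
  rewrite {1}E zrD mulrDl zrM.
  rewrite (_ : zr (Z.div j 4) * zr 4 * (pi / 2) = zr (Z.div j 4) * (2 * pi)).
    exact: cos_int_periodic.
  by rewrite -mulrA; congr (_ * _); rewrite (_ : zr 4 = 4%:R) //; field.
have pi2 : zr 2 * (pi / 2) = pi :> R by rewrite (_ : zr 2 = 2%:R) //; field.
have H : [\/ Z.modulo j 4 = 0, Z.modulo j 4 = 1, Z.modulo j 4 = 2 |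
              Z.modulo j 4 = 3]%BZ.
  have [lo hi] : (0 <= Z.modulo j 4 < 4)%BZ by apply: Z.mod_pos_bound.
  by case: (Z.modulo j 4) lo hi => [|[[]|[]|]|] //=; lia || constructor.
rewrite /cos_quarter; case: H => ->.
- by rewrite mul0r cos0.
- by rewrite mul1r cos_pihalf.
- by rewrite pi2 cospi.
- rewrite (_ : zr 3 = zr 2 + 1); last by rewrite -zr1 -zrD.
  by rewrite mulrDl pi2 mul1r cosDpihalf sinpi oppr0.
Qed.

Lemma integrable_cos_tangle n k :
  (lebesgue_tuple n).-integrable (@torus_cell R n)
    (fun x => (cos (tangle k (\row_i tnth x i)))%:E).
Proof.
apply: (integrable_torus_cell (M := 1)) => [|x]; last exact: cos_max.
apply: (eq_measurable_fun _ _ (measurable_cos_tuple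
  (fun i : 'I_n => int_of_Z (nth Z0 k i.+1)) (zr (nth Z0 k 0) * (pi / 2)))).
move=> x _ /=; congr cos; congr (_ + _); apply: eq_bigr => i _; rewrite mxE //.
Qed.

Lemma torus_integral_cos_tangle n k :
  torus_integral (fun x : 'rV[R]_n => cos (tangle k x)) =
  (if const_freq n k then (2 * pi) ^+ n * zr (cos_quarter (nth Z0 k 0)) else 0)%:E.
Proof.
have -> : const_freq n k = [forall i : 'I_n, int_of_Z (nth Z0 k i.+1) == 0].
  apply/allP/forallP => [h i|h i].
    by have := h i; rewrite mem_iota add0n ltn_ord => /(_ isT); lia.
  by rewrite mem_iota add0n => /andP[_ ni]; have := h (Ordinal ni) => /=; lia.
rewrite -cos_quarterE -integral_torus_cos; apply: eq_integral => x _.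
congr (cos _)%:E; congr (_ + _); apply: eq_bigr => i _; rewrite mxE //.
Qed.

Lemma integrable_teval n p :
  (lebesgue_tuple n).-integrable (@torus_cell R n)
    (fun x => (teval p (\row_i tnth x i))%:E).
Proof.
rewrite /teval; under eq_fun do rewrite -sumEFin.
apply: integrable_sum; first exact: measurable_torus_cell.
move=> t _; under eq_fun do rewrite EFinM.
apply: integrableZl; first exact: measurable_torus_cell.
exact: integrable_cos_tangle.
Qed.

Lemma torus_integral_teval n p :
  torus_integral (@teval R n p) = ((2 * pi) ^+ n * zr (tmean n p))%:E.
Proof.
rewrite /torus_integral /teval.
under eq_integral do rewrite -sumEFin.
rewrite integral_sum //; last 2 first.
- exact: measurable_torus_cell.
- move=> t; under eq_fun do rewrite EFinM.
  apply: integrableZl; first exact: measurable_torus_cell.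
  exact: integrable_cos_tangle.
rewrite (eq_bigr (fun t => (zr t.1 * (if const_freq n t.2
    then (2 * pi) ^+ n * zr (cos_quarter (nth Z0 t.2 0))
    else 0))%:E)); last first.
  move=> t _; under eq_integral do rewrite EFinM.
  rewrite integralZl; last exact: integrable_cos_tangle.
    by rewrite EFinM -torus_integral_cos_tangle.
  exact: measurable_torus_cell.
rewrite sumEFin; congr EFin; move: ((2 * pi) ^+ n) => w.
elim: p => [|t p IH] /=; first by rewrite big_nil mulr0.
rewrite big_cons IH; case: ifP => _; last by rewrite mulr0 add0r.
by rewrite zrD zrM mulrDr [in LHS]mulrCA.
Qed.

(** The criterion behind both counterexamples: a trigonometric perturbation
    along which the increment of F is dominated by a trigonometric polynomial
    of negative mean. *)
Lemma not_quasiconvex_trig m n (F : 'M[R]_(m, n) -> R) A p (K : R) h :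
  0 < K -> (tmean n h < 0)%BZ ->
  (forall x, K * (F (A + Dmx (tmap m p) x) - F A) <= teval h x) ->
  ~ quasiconvex F.
Proof.
move=> K0 mh Fh qF; have := qF A (@tmap R m n p) (@smooth_tmap R m n p).
apply/negP; rewrite -ltNge.
apply: (@le_lt_trans _ _ (\int[lebesgue_tuple n]_(x in @torus_cell R n)
    (K^-1%:E * (teval h (\row_i tnth x i))%:E))%E).
  apply: le_integral_pointwise => x _.
  by rewrite -EFinM lee_fin -ler_pdivrMl ?invr_gt0 // invrK; exact: Fh.
rewrite integralZl; [|exact: measurable_torus_cell|exact: integrable_teval].
rewrite [X in (_ * X)%E]torus_integral_teval -EFinM lte_fin.
rewrite pmulr_rlt0 ?invr_gt0 // pmulr_rlt0 ?exprn_gt0 ?mulr_gt0 ?pi_gt0 //.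
rewrite /realZ ltrz0; lia.
Qed.

End torus_integrals.

(** * Failure of quasiconvexity on 6 x 2 matrices *)

Definition cosx : tpoly := [:: (1, [:: 0; 1; 0])]%BZ.
Definition cosy : tpoly := [:: (1, [:: 0; 0; 1])]%BZ.
Definition cosxy : tpoly := [:: (1, [:: 0; 1; 1])]%BZ.
Definition sinx : tpoly := [:: (1, [:: -1; 1; 0])]%BZ.
Definition siny : tpoly := [:: (1, [:: -1; 0; 1])]%BZ.
Definition sinxy : tpoly := [:: (1, [:: -1; 1; 1])]%BZ.
(** The amplitude cos x multiplies (k, -j) in xi, cos y multiplies (-k, i) in
    eta, and cos (x + y) multiplies (i + j, 0) in both. *)
Definition waves62 : seq tpoly :=
  [:: sinxy; sinxy; sinx ++ tscale (-1)%BZ siny; siny; tscale (-1)%BZ sinx; [::]].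
(** With r, s, t the three cosines this is
    8 (- 4 r s t + (r s)^2 + (r t)^2 + (s t)^2); an iterated product of m factors
    carries a factor 2^(m-1). *)
Definition excess62 : tpoly :=
  tscale (-8)%BZ (tmul (tmul cosx cosy) cosxy) ++
  tmul (tmul cosx cosy) (tmul cosx cosy) ++
  tmul (tmul cosx cosxy) (tmul cosx cosxy) ++
  tmul (tmul cosy cosxy) (tmul cosy cosxy).

Section not_quasiconvex_6x2.
Context {R : realType}.
Local Notation zr := (@realZ R).

(** The matrix with columns (i, k) and (j, k). *)
Definition base62 : 'M[R]_(6, 2) :=
  \matrix_(i, j) nth 0 (nth [::] [:: [:: 1; 0]; [:: 0; 1]; [:: 0; 0];
                                     [:: 0; 0]; [:: 0; 0]; [:: 1; 1]] i) j.

Lemma gram_im_waves62 (r s t : R) :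
  gram_im (1 + t) t r 0 (- r) 1 t (1 + t) (- s) s 0 1 =
  2 * (1 - 4 * (r * s * t) + (r * s) ^+ 2 + (r * t) ^+ 2 + (s * t) ^+ 2).
Proof. by rewrite /gram_im; ring. Qed.

Lemma not_quasiconvex_Gim : ~ quasiconvex (@Gim R).
Proof.
have gA : Gim base62 = Num.sqrt 2.
  rewrite GimE /Gim_gram !mxE /=; congr Num.sqrt; rewrite /gram_im; ring.
apply: (@not_quasiconvex_trig _ _ _ _ base62 waves62 (8 * Num.sqrt 2) excess62).
- by rewrite mulr_gt0 // sqrtr_gt0.
- by [].
move=> x.
pose r := teval cosx x; pose s := teval cosy x; pose t := teval cosxy x.
have -> : teval excess62 x =
    8 * (- 4 * (r * s * t) + (r * s) ^+ 2 + (r * t) ^+ 2 + (s * t) ^+ 2).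
  rewrite /excess62 (teval_cat (tscale _ _)) !(teval_cat (tmul _ _)).
  rewrite teval_scale !teval_mul -/r -/s -/t.
  rewrite (_ : zr (-8)%BZ = - 8%:R) //; ring.
have gram62E : Gim_gram (base62 + Dmx (tmap 6 waves62) x) =
    gram_im (1 + t) t r 0 (- r) 1 t (1 + t) (- s) s 0 1.
  rewrite Dmx_tmap /Gim_gram !mxE /=.
  rewrite /r /s /t /teval !big_cons !big_nil /= zr0 zr1 (zrN 1) zr1.
  by rewrite !(mul0r, mul1r, mulN1r, add0r, addr0).
set g := Gim _; have gE : g ^+ 2 =
    2 * (1 - 4 * (r * s * t) + (r * s) ^+ 2 + (r * t) ^+ 2 + (s * t) ^+ 2).
  by rewrite /g GimE sqr_sqrtr; [rewrite gram62E gram_im_waves62|exact: gram_im_ge0].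
(* 2 sqrt 2 g <= g^2 + 2 bounds the square root by its tangent at 2. *)
have := sqr_ge0 (g - Num.sqrt 2).
have : Num.sqrt 2 ^+ 2 = 2 :> R by rewrite sqr_sqrtr.
rewrite gA; move: (Num.sqrt 2) => w w2 h; nra.
Qed.
End not_quasiconvex_6x2.

(** * Failure of quasiconvexity on 2 x 6 matrices *)

Definition wave (k : seq Z) : tpoly := [:: (1%BZ, 0%BZ :: k)].

(** The function f, with e embedding its frequencies: three waves of amplitude 4
    whose frequencies (1,0), (0,1), -(1,1) sum to zero, and the difference wave
    (1,-1) with amplitude 1.  The ratio 1/4 is one of those for which the mean
    of D is negative. *)
Definition profile (e : Z -> Z -> seq Z) : tpoly :=
  tscale 4 (wave (e 1 0) ++ wave (e 0 1) ++ wave (e 1 1)) ++ wave (e 1 (-1)).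

(* Coordinates (0, 1) are x and (3, 4) are y, the i and j components of the
   two quaternions of a row; nothing depends on the k components, 2 and 5. *)
Definition fx := profile (fun a b => [:: a; b; 0; 0; 0; 0]%BZ).
Definition fy := profile (fun a b => [:: 0; 0; 0; a; b; 0]%BZ).
Definition fxy := profile (fun a b => [:: a; b; 0; a; b; 0]%BZ).
Definition waves26 : seq tpoly :=
  [:: fy ++ tscale (-1) fxy; fxy ++ tscale (-1) fx].

Definition dwaves26 (k i : nat) : tpoly :=
  tcollect (tderiv i (nth [::] waves26 k)).
Definition tdet (p q r s : tpoly) : tpoly :=
  tcollect (tmul p s ++ tscale (-1) (tmul q r)).

(** The planar cross products in D, with a and b the gradients of the first
    function in x and y, and c the gradient of the second one in x; each
    evaluates to twice the cross product. *)
Definition bc : tpoly :=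
  tdet (dwaves26 0 3) (dwaves26 0 4) (dwaves26 1 0) (dwaves26 1 1).
Definition ab : tpoly :=
  tdet (dwaves26 0 0) (dwaves26 0 1) (dwaves26 0 3) (dwaves26 0 4).
Definition ac : tpoly :=
  tdet (dwaves26 0 0) (dwaves26 0 1) (dwaves26 1 0) (dwaves26 1 1).

(** q and D, with the factors 2 and 8 accumulated by [tmul]. *)
Definition twoq : tpoly :=
  tmul (dwaves26 0 0) (dwaves26 0 0) ++ (tmul (dwaves26 0 1) (dwaves26 0 1) ++
  (tmul (dwaves26 0 3) (dwaves26 1 0) ++ tmul (dwaves26 0 4) (dwaves26 1 1))).
Definition eightD : tpoly := tmul bc bc ++ tscale (-4) (tmul ab ac).

(** 8 (2 n q + D + d), which dominates 16 n (G - n) for n = N^2;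
    see [sqrt_le_expansion]. *)
Definition excess26 (n d : Z) : tpoly :=
  tscale (Z.mul 8 n) twoq ++ (eightD ++ [:: (Z.mul 8 d, [::])]).

Section not_quasiconvex_2x6.
Context {R : realType}.
Local Notation zr := (@realZ R).

(** The first two terms of the expansion of the square root for large n, with
    the higher ones absorbed in the slack d. *)
Lemma sqrt_le_expansion (n q D d B B' : R) :
  0 < n -> `|q| <= B -> `|D| <= B' -> 0 <= d -> 2 * B <= n -> B' <= n ^+ 2 ->
  B * (B' + d) <= d * n ->
  2 * n * (Num.sqrt ((n + q) ^+ 2 + D) - n) <= 2 * n * q + D + d.
Proof.
move=> n0 qB DB d0 Bn B'n Bd.
pose y := n + q + (D + d) / (2 * n).
move: (qB) (DB); rewrite !ler_norml => /andP[q1 q2] /andP[D1 D2].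
have yE : 2 * n * y = 2 * n * (n + q) + D + d by rewrite /y; field; rewrite gt_eqF.
have y0 : 0 <= y.
  rewrite -(pmulr_rge0 _ (_ : 0 < 2 * n)) ?mulr_gt0 // yE.
  by nra.
have qDd : `|q * (D + d)| <= d * n.
  apply: le_trans Bd; rewrite normrM ler_pM //.
  by rewrite (le_trans (ler_normD _ _)) // lerD // ger0_norm.
move: qDd; rewrite ler_norml => /andP[lo _].
suff : Num.sqrt ((n + q) ^+ 2 + D) <= y.
  rewrite mulrBr => h; have := ler_wpM2l (ltW (mulr_gt0 (ltr0Sn R 1) n0)) h.
  by rewrite yE; lra.
rewrite -[leRHS]ger0_norm // -sqrtr_sqr ler_sqrt ?sqr_ge0 //.
rewrite -subr_ge0 -(pmulr_rge0 _ n0).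
rewrite [X in 0 <= X](_ : _ = d * n + q * (D + d) + n * ((D + d) / (2 * n)) ^+ 2).
  apply: addr_ge0; first by rewrite -lerBlDl sub0r.
  by rewrite mulr_ge0 ?sqr_ge0 ?ltW.
by rewrite /y; field; rewrite gt_eqF.
Qed.

(** Thanks to the last entries - a, G^2 is a perfect square up to a quartic. *)
Lemma gram_im_near_base26 (n a1 a2 b1 b2 c1 c2 : R) :
  gram_im a1 a2 n b1 b2 0 c1 c2 0 (- a1) (- a2) n =
  (n ^+ 2 + (a1 ^+ 2 + a2 ^+ 2 + b1 * c1 + b2 * c2)) ^+ 2 +
  ((b1 * c2 - b2 * c1) ^+ 2 -
   4 * ((a1 * b2 - a2 * b1) * (a1 * c2 - a2 * c1))).
Proof. by rewrite /gram_im; ring. Qed.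

(** N, large enough for the bounds of [sqrt_le_expansion]. *)
Definition scale26 := 2000%BZ.

(** Rows scale26 (k, 0) and scale26 (0, k). *)
Definition base26 : 'M[R]_(2, 6) :=
  \matrix_(i, j) nth 0 (nth [::] [:: [:: 0; 0; zr scale26];
                             [:: 0; 0; 0; 0; 0; zr scale26]] i) j.

Lemma teval_const n c (x : 'rV[R]_n) : teval [:: (c, [::])] x = zr c.
Proof.
rewrite /teval big_cons big_nil addr0 /tangle /= mul0r add0r big1 ?cos0 ?mulr1 //.
by move=> i _; exact: mul0r.
Qed.

Lemma teval_d2 (n k i : nat) (x : 'rV[R]_n) :
  teval (tderiv i (nth [::] waves26 k)) x = teval (dwaves26 k i) x.
Proof. by rewrite teval_collect. Qed.

Lemma teval_tdet n p q r s (x : 'rV[R]_n) :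
  teval (tdet p q r s) x = 2 * (teval p x * teval s x - teval q x * teval r x).
Proof.
rewrite teval_collect (teval_cat (tmul _ _)) teval_scale !teval_mul (zrN 1) zr1; ring.
Qed.

Lemma not_quasiconvex_GimT : ~ quasiconvex (@GimT R).
Proof.
have zN0 : 0 < zr scale26 by rewrite /realZ ltr0z.
have gA : GimT base26 = zr scale26 ^+ 2.
  rewrite /GimT GimE /Gim_gram !mxE /= -[RHS]ger0_norm ?sqr_ge0 // -sqrtr_sqr.
  by congr Num.sqrt; rewrite /gram_im; ring.
(* The mean of 8 D is -576, so the slack may be any integer below 72. *)
apply: (@not_quasiconvex_trig _ _ _ _ base26 waves26 (16 * zr scale26 ^+ 2)
  (excess26 (Z.mul scale26 scale26) 71%BZ)).
- by rewrite mulr_gt0 // exprn_gt0.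
- by vm_compute.
move=> x; rewrite gA.
(* The k components of the gradient vanish, and the gradient of the second
   function in y is - a. *)
have vanish k i : dwaves26 k i = [::] -> teval (dwaves26 k i) x = 0.
  by move=> ->; exact: big_nil.
have opp k i l j : tcollect (dwaves26 k i ++ dwaves26 l j) = [::] ->
    teval (dwaves26 k i) x = - teval (dwaves26 l j) x.
  move=> E; apply/eqP; rewrite -addr_eq0 -teval_cat -teval_collect E.
  by rewrite /teval big_nil.
set a1 := teval (dwaves26 0 0) x; set a2 := teval (dwaves26 0 1) x.
set b1 := teval (dwaves26 0 3) x; set b2 := teval (dwaves26 0 4) x.
set c1 := teval (dwaves26 1 0) x; set c2 := teval (dwaves26 1 1) x.
have gE : GimT (base26 + Dmx (tmap 2 waves26) x) =
    Num.sqrt (gram_im a1 a2 (zr scale26) b1 b2 0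
                      c1 c2 0 (- a1) (- a2) (zr scale26)).
  rewrite /GimT GimE /Gim_gram Dmx_tmap !mxE !teval_d2.
  congr (Num.sqrt (gram_im _ _ _ _ _ _ _ _ _ _ _ _)).
  - exact: add0r.
  - exact: add0r.
  - by rewrite (vanish 0 2)%N ?addr0 //; vm_compute.
  - exact: add0r.
  - exact: add0r.
  - by rewrite (vanish 0 5)%N ?addr0 //; vm_compute.
  - exact: add0r.
  - exact: add0r.
  - by rewrite (vanish 1 2)%N ?addr0 //; vm_compute.
  - by rewrite (opp 1 3 0 0)%N ?add0r //; vm_compute.
  - by rewrite (opp 1 4 0 1)%N ?add0r //; vm_compute.
  - by rewrite (vanish 1 5)%N ?addr0 //; vm_compute.
rewrite gE gram_im_near_base26.
set q := a1 ^+ 2 + _ + _ + _; set D := (X in Num.sqrt (_ + X)).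
have qE : teval twoq x = 2 * q.
  rewrite /twoq !(teval_cat (tmul _ _)) !teval_mul.
  by rewrite -/a1 -/a2 -/b1 -/b2 -/c1 -/c2 /q; ring.
have DE : teval eightD x = 8 * D.
  rewrite /eightD (teval_cat (tmul _ _)) teval_scale !teval_mul !teval_tdet.
  by rewrite -/a1 -/a2 -/b1 -/b2 -/c1 -/c2 /D (_ : zr (-4)%BZ = - 4%:R) //; ring.
have eE : teval (excess26 (Z.mul scale26 scale26) 71%BZ) x =
    8 * (2 * zr scale26 ^+ 2 * q + D + zr 71%BZ).
  rewrite /excess26 (teval_cat (tscale _ _)) (teval_cat eightD) teval_scale qE DE.
  rewrite teval_const !zrM (_ : zr 8%BZ = 8%:R) //; ring.
rewrite eE.
have zr2 : 2 = zr 2%BZ by [].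
have zr8 : 8 = zr 8%BZ by [].
have qB : `|q| <= zr 810%BZ.
  rewrite -(ler_pM2l (ltr0Sn R 1)) -[X in X * _](ger0_norm (ler0n R 2)) -normrM -qE.
  apply: le_trans (norm_teval_le twoq x) _; rewrite zr2 -zrM; apply: zr_le.
  by vm_compute.
have DB : `|D| <= zr 255040%BZ.
  rewrite -(ler_pM2l (ltr0Sn R 7)) -[X in X * _](ger0_norm (ler0n R 8)) -normrM -DE.
  apply: le_trans (norm_teval_le eightD x) _; rewrite zr8 -zrM; apply: zr_le.
  by vm_compute.
have := @sqrt_le_expansion (zr scale26 ^+ 2) q D (zr 71%BZ) _ _
  (exprn_gt0 _ zN0) qB DB.
have c1' : 0 <= zr 71%BZ by rewrite -zr0; apply: zr_le.
have c2' : 2 * zr 810%BZ <= zr scale26 ^+ 2 by rewrite zr2 expr2 -!zrM; apply: zr_le.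
have c3' : zr 255040%BZ <= zr scale26 ^+ 2 ^+ 2 by rewrite !expr2 -!zrM; apply: zr_le.
have c4' : zr 810%BZ * (zr 255040%BZ + zr 71%BZ) <= zr 71%BZ * zr scale26 ^+ 2.
  by rewrite !expr2 -zrD -!zrM; apply: zr_le.
move=> /(_ c1' c2' c3' c4').
move: (zr scale26 ^+ 2) (zr 71%BZ) => n d h; lra.
Qed.
End not_quasiconvex_2x6.

Theorem theorem1p2 (R : realType) :
  (rank_one_convex (@Gim R) /\ ~ quasiconvex (@Gim R)) /\
  (rank_one_convex (@GimT R) /\ ~ quasiconvex (@GimT R)).
Proof.
split; split.
- exact: rank_one_convex_Gim.
- exact: not_quasiconvex_Gim.
- exact: rank_one_convex_GimT.
- exact: not_quasiconvex_GimT.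
Qed.
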